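(* For each $m\ge0$ let $\beta_m\in S_{2m}$ be a fixed-point free involution. Then, as formal power series, \[ \sum_{m,j\ge0}c(2j,\beta_m)\frac{z^m}{m!}\frac{u^j}{j!}=\left((1-2z)\sqrt{1-\frac{4zu}{1-2z}}\,\exp\Big(\frac{2zu}{1-2z}\Big)\right)^{-1}. \]
   Context: $c(k,\beta)$ is the number of $\alpha\in S_{2m}$ with $H(\alpha\beta,\beta\alpha)=k$, where $H(\sigma,\tau)=|\{a:\sigma(a)\ne\tau(a)\}|$ is the Hamming metric; $S_0$ is the trivial group. A fixed-point free involution of $[2m]$ is a product of $m$ disjoint transpositions covering $[2m]$. *)

(* Defs.v *)
From HB Require Import structures.
From mathcomp Require Import all_boot all_fingroup all_algebra.
From mathcomp Require Import boolp.

Set Implicit Arguments.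
Unset Strict Implicit.
Unset Printing Implicit Defensive.

Import GRing.Theory.
Local Open Scope ring_scope.

Section Hamming.

Definition hamming (T : finType) (s t : {perm T}) : nat :=
  #|[set a | s a != t a]|.

(* Products of permutations compose from left to right in the library; by
   symmetry of the Hamming metric the count does not depend on this choice. *)
Definition cnum (n k : nat) (beta : 'S_n) : nat :=
  #|[set alpha : 'S_n | hamming (alpha * beta)%g (beta * alpha)%g == k]|.

(* [t] lists [m] pairs whose [2 * m] entries are distinct and exhaust the
   domain. *)
Definition fpf_involution (m : nat) (beta : 'S_(2 * m)) : Prop :=
  exists t : m.-tuple ('I_(2 * m) * 'I_(2 * m)),
    let entries := flatten [seq [:: p.1; p.2] | p <- t] in
    [/\ uniq entries,
        forall a : 'I_(2 * m), a \in entries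
      & beta = (\prod_(p <- t) tperm p.1 p.2)%g].

End Hamming.

(* Formal power series in one variable over R; iterating the construction gives
   R[[u]][[z]] = {fps {fps R}}. *)
Variant fpseries (R : Type) := FPSeries of nat -> R.

Notation "{ 'fps' R }" := (fpseries R) (at level 0, R at level 200,
  format "{ 'fps'  R }") : type_scope.

Definition fcoef (R : Type) (f : {fps R}) (n : nat) : R :=
  let: FPSeries a := f in a n.

Notation "\fps_ n E" := (FPSeries (fun n : nat => E))
  (at level 36, E at level 36, n at level 2, format "\fps_ n  E") : ring_scope.

HB.instance Definition _ (R : Type) := gen_eqMixin {fps R}.
HB.instance Definition _ (R : Type) := gen_choiceMixin {fps R}.

Lemma fpsP (R : Type) (f g : {fps R}) : fcoef f =1 fcoef g -> f = g.
Proof. by case: f => a; case: g => b ab; congr FPSeries; apply/funext. Qed.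

Section Zmodule.
Variable R : zmodType.
Implicit Types f g : {fps R}.

Definition fps_zero : {fps R} := \fps_n 0.
Definition fps_opp f : {fps R} := \fps_n (- fcoef f n).
Definition fps_add f g : {fps R} := \fps_n (fcoef f n + fcoef g n).

Lemma fps_addA : associative fps_add.
Proof. by move=> f g h; apply: fpsP => n /=; rewrite addrA. Qed.
Lemma fps_addC : commutative fps_add.
Proof. by move=> f g; apply: fpsP => n /=; rewrite addrC. Qed.
Lemma fps_add0 : left_id fps_zero fps_add.
Proof. by move=> f; apply: fpsP => n /=; rewrite add0r. Qed.
Lemma fps_addN : left_inverse fps_zero fps_opp fps_add.
Proof. by move=> f; apply: fpsP => n /=; rewrite addNr. Qed.

HB.instance Definition _ :=
  GRing.isZmodule.Build {fps R} fps_addA fps_addC fps_add0 fps_addN.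

Lemma fcoef0 n : fcoef (0 : {fps R}) n = 0. Proof. by []. Qed.
Lemma fcoefD f g n : fcoef (f + g) n = fcoef f n + fcoef g n.
Proof. by []. Qed.
Lemma fcoefN f n : fcoef (- f) n = - fcoef f n. Proof. by []. Qed.
Lemma fcoefB f g n : fcoef (f - g) n = fcoef f n - fcoef g n.
Proof. by []. Qed.
Lemma fcoef_sum (I : Type) (r : seq I) (P : pred I) (F : I -> {fps R}) n :
  fcoef (\sum_(i <- r | P i) F i) n = \sum_(i <- r | P i) fcoef (F i) n.
Proof. by elim/big_rec2: _ => // i x y _ <-. Qed.

End Zmodule.

Section Ring.
Variable R : comNzRingType.
Implicit Types f g h : {fps R}.

Definition fpsC (c : R) : {fps R} := \fps_n (if n == 0 then c else 0).
Definition fpsX : {fps R} := \fps_n (n == 1)%:R.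

Definition fps_mul f g : {fps R} :=
  \fps_n (\sum_(i < n.+1) fcoef f i * fcoef g (n - i)).

Let trunc n f : {poly R} := \poly_(i < n.+1) fcoef f i.

Let truncE n f i : (i <= n)%N -> (trunc n f)`_i = fcoef f i.
Proof. by move=> le_in; rewrite coef_poly ltnS le_in. Qed.

Let trunc_mul n f g i :
  (i <= n)%N -> (trunc n f * trunc n g)`_i = fcoef (fps_mul f g) i.
Proof.
move=> le_in; rewrite coefM; apply: eq_bigr => j _.
have le_jn : (j <= n)%N by apply: leq_trans le_in; rewrite -ltnS.
by rewrite !truncE // (leq_trans (leq_subr _ _)).
Qed.

Lemma fps_mulC : commutative fps_mul.
Proof.
move=> f g; apply: fpsP => n.
by rewrite -(trunc_mul f g (leqnn n)) mulrC trunc_mul.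
Qed.

Lemma fps_mulA : associative fps_mul.
Proof.
move=> f g h; apply: fpsP => n.
transitivity ((trunc n f * (trunc n g * trunc n h))`_n).
  rewrite coefM; apply: eq_bigr => j _.
  by rewrite truncE 1?trunc_mul ?leq_subr // -ltnS.
rewrite mulrA coefM; apply: eq_bigr => j _.
by rewrite truncE ?leq_subr // trunc_mul // -ltnS.
Qed.

Lemma fps_mul1 : left_id (fpsC 1) fps_mul.
Proof.
move=> f; apply: fpsP => n /=; rewrite big_ord_recl /= mul1r subn0.
by rewrite big1 ?addr0 // => i _; rewrite mul0r.
Qed.

Lemma fps_mulD : left_distributive fps_mul (@fps_add R).
Proof.
move=> f g h; apply: fpsP => n /=; rewrite -big_split /=.
by apply: eq_bigr => i _; rewrite mulrDl.
Qed.

Lemma fps_oner_neq0 : fpsC 1 != 0.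
Proof.
by apply/eqP => /(congr1 (fun f => fcoef f 0)) /eqP; rewrite /= oner_eq0.
Qed.

HB.instance Definition _ := GRing.Zmodule_isComNzRing.Build {fps R}
  fps_mulA fps_mulC fps_mul1 fps_mulD fps_oner_neq0.

Lemma fcoef1 n : fcoef (1 : {fps R}) n = (n == 0)%:R.
Proof. by rewrite /=; case: (n == 0). Qed.
Lemma fcoefM f g n :
  fcoef (f * g) n = \sum_(i < n.+1) fcoef f i * fcoef g (n - i).
Proof. by []. Qed.
Lemma fcoef0M f g : fcoef (f * g) 0 = fcoef f 0 * fcoef g 0.
Proof. by rewrite fcoefM big_ord1. Qed.

Lemma fcoefCM c f n : fcoef (fpsC c * f) n = c * fcoef f n.
Proof.
rewrite fcoefM big_ord_recl /= subn0 big1 ?addr0 // => i _.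
by rewrite mul0r.
Qed.

Lemma fcoefX_small f k n : fcoef f 0 = 0 -> (n < k)%N -> fcoef (f ^+ k) n = 0.
Proof.
move=> f0; elim: k n => // k IHk n lt_nk.
rewrite exprS fcoefM big_ord_recl f0 mul0r add0r big1 // => i _.
rewrite IHk ?mulr0 //= /bump /= add1n.
by case: n lt_nk i => [|n] lt_nk i; [case: i | rewrite subSS ltnS in lt_nk *;
  apply: leq_ltn_trans (leq_subr _ _) _].
Qed.

(* The substitution a_0 + a_1 f + a_2 f^2 + ..., meaningful only when f has
   zero constant term: then f ^+ k has no term of degree < k, and the infinite
   sum may be cut off at k = n in degree n. *)
Definition fps_subst (a : nat -> R) f : {fps R} :=
  \fps_n (\sum_(k < n.+1) a k * fcoef (f ^+ k) n).

Lemma fps_substE a f n N : fcoef f 0 = 0 -> (n < N)%N ->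
  fcoef (fps_subst a f) n = fcoef (\sum_(k < N) fpsC (a k) * f ^+ k) n.
Proof.
move=> f0 lt_nN; rewrite fcoef_sum.
transitivity (\sum_(k < n.+1) a k * fcoef (f ^+ k) n) => //.
rewrite (big_ord_widen N (fun k => a k * fcoef (f ^+ k) n)) //.
rewrite big_mkcond; apply: eq_bigr => k _; rewrite fcoefCM.
by case: ltnP => // lt_nk; rewrite fcoefX_small ?mulr0.
Qed.

End Ring.

Section UnitRing.
Variable R : comUnitRingType.
Implicit Types f g : {fps R}.

Definition fps_unit : {pred {fps R}} :=
  [pred f | fcoef f 0 \is a GRing.unit].

(* With c the constant term of f, this is c^-1 times the geometric series of
   1 - c^-1 f. *)
Definition fps_inv f : {fps R} :=
  if f \in fps_unit then
    fpsC (fcoef f 0)^-1 *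
      fps_subst (fun=> 1) (1 - fpsC (fcoef f 0)^-1 * f)
  else f.

Lemma fps_mulV : {in fps_unit, left_inverse 1 fps_inv *%R}.
Proof.
move=> f Uf; rewrite /fps_inv Uf.
set c := fpsC _; set h := 1 - c * f.
have h0 : fcoef h 0 = 0.
  by rewrite fcoefB fcoefCM fcoef1 mulVr ?subrr.
rewrite mulrAC (_ : c * f = 1 - h); last by rewrite /h subKr.
apply: fpsP => n.
transitivity (fcoef ((1 - h) * \sum_(k < n.+1) h ^+ k) n).
  rewrite !fcoefM; apply: eq_bigr => i _; congr (_ * _).
  rewrite (@fps_substE _ _ _ _ n.+1) // ?ltnS ?leq_subr //.
  by rewrite !fcoef_sum; apply: eq_bigr => k _; rewrite fcoefCM mul1r.
rewrite -opprB mulNr -subrX1 opprB fcoefB fcoefX_small ?subr0 //.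
Qed.

Lemma fps_unitPl f g : g * f = 1 -> fps_unit f.
Proof.
move/(congr1 (fun h => fcoef h 0)); rewrite fcoef0M fcoef1 /= => gf1.
by apply/unitrPr; exists (fcoef g 0); rewrite mulrC.
Qed.

Lemma fps_inv_out : {in [predC fps_unit], fps_inv =1 id}.
Proof. by move=> f /negPf nUf; rewrite /fps_inv [f \in _]nUf. Qed.

HB.instance Definition _ := GRing.ComNzRing_hasMulInverse.Build {fps R}
  fps_mulV fps_unitPl fps_inv_out.

(* For f with zero constant term (R containing the rationals). *)
Definition fps_exp f : {fps R} := fps_subst (fun k => (k`!%:R)^-1) f.

(* Generalized binomial coefficient "1/2 choose k". *)
Definition binom_half (k : nat) : R :=
  (\prod_(i < k) (2^-1 - i%:R)) / k`!%:R.

(* For f with constant term 1: the binomial series of (1 + (f - 1)) ^ (1/2),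
   i.e. the square root of f with constant term 1. *)
Definition fps_sqrt f : {fps R} := fps_subst binom_half (f - 1).

End UnitRing.

Arguments fpsX {R}.

(* Main.v *)
(* Write b for the involution and let D(s) be the set of points a with
   b (s a) = s (b a); then s b and b s are at distance 2m - |D(s)|, and D(s) is
   a union of 2-cycles of b. The permutations s with D(s) containing i given
   2-cycles number 2^m m! (2(m - i) - 1)!!, so binomial inversion gives
   c(2k, b) = 2^m m! C(m, k) d_k, where d_k = sum_l (-1)^(k - l) C(k, l) (2l - 1)!!
   has exponential generating function exp(- x) (1 - 2x)^(-1/2). Finally
   sum_m 2^m C(m, k) z^m = (2z)^k / (1 - 2z)^(k + 1), so the sum over m and k is
   1 / (1 - 2z) times that function at x = 2zu / (1 - 2z). *)
Require Import Defs.
From mathcomp Require Import all_boot all_fingroup all_algebra.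
From HB Require Import structures.
From mathcomp Require Import zify ring.

Set Implicit Arguments.
Unset Strict Implicit.
Unset Printing Implicit Defensive.

Import GRing.Theory.
Local Open Scope ring_scope.

(* [odd_fact n] is (2n - 1)!! *)
Definition odd_fact (n : nat) : nat := \prod_(i < n) (2 * i).+1.

Lemma odd_factS n : odd_fact n.+1 = (odd_fact n * (2 * n).+1)%N.
Proof. by rewrite /odd_fact big_ord_recr. Qed.

Lemma fact_double n : (2 * n)`! = (2 ^ n * n`! * odd_fact n)%N.
Proof.
elim: n => [|n IHn]; first by rewrite /odd_fact big_ord0.
by rewrite odd_factS mulnS !factS IHn expnS; nia.
Qed.

(** * Counting permutations that commute with an involution at prescribed points *)

Section Commutation.
Variables (T : finType) (b : {perm T}) (reps : {set T}).
Hypothesis b_inv : forall a, b (b a) = a.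
(* [reps] contains exactly one point of each pair [{a, b a}], so [b] has no
   fixed point. *)
Hypothesis b_reps : forall a, (b a \in reps) = (a \notin reps).

Definition commuting_points (s : {perm T}) : {set T} :=
  [set a | b (s a) == s (b a)].

Definition commuting_perms (S : {set T}) : {set {perm T}} :=
  [set s | S \subset commuting_points s].

Let b_neq a : b a != a.
Proof. by apply/eqP => /(congr1 (mem reps)); rewrite /= b_reps; case: (a \in _). Qed.

Lemma commuting_pointsV s a :
  (b a \in commuting_points s) = (a \in commuting_points s).
Proof.
by rewrite !inE b_inv eq_sym -(inj_eq (@perm_inj _ b)) b_inv eq_sym eq_sym.
Qed.

(** [b] maps the points of [D] inside [reps] bijectively onto those outside. *)
Lemma card_stable (D : {set T}) :
  (forall a, (b a \in D) = (a \in D)) -> #|D| = (2 * #|D :&: reps|)%N.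
Proof.
move=> Db; rewrite -(cardsID reps D) mul2n -addnn; congr addn.
rewrite -[RHS](card_imset _ (@perm_inj _ b)); apply: eq_card => a.
rewrite -[in RHS](b_inv a) (mem_imset _ _ (@perm_inj _ b)) !inE Db b_reps.
by rewrite andbC.
Qed.

(** The two products agree exactly on [commuting_points s]; this set and [T] are both stable under
    [b], so [card_stable] measures both. *)
Lemma hamming_commuting s :
  hamming (s * b)%g (b * s)%g = (2 * (#|reps| - #|commuting_points s :&: reps|))%N.
Proof.
rewrite mulnBr -card_stable; last exact: commuting_pointsV.
rewrite (_ : (2 * #|reps|)%N = #|T|); last first.
  by rewrite -cardsT (@card_stable [set: T]) ?setTI // => a; rewrite !inE.
rewrite /hamming -(cardsC (commuting_points s)) addKn.
by apply: eq_card => a; rewrite !inE !permM.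
Qed.

(* Given [s] commuting with [b] on [S], the point [y] with [s y = b (s x)] can
   be any point other than [x] outside of [S] and [b @: S]; exchanging [y] with
   [b x] shows that all these values are taken equally often, and [y = b x]
   means that [s] also commutes with [b] at [x]. *)
Lemma card_commuting_perms_step (S : {set T}) x :
    S \subset reps -> x \in reps -> x \notin S ->
  #|commuting_perms S| =
    ((2 * (#|reps| - #|S|)).-1 * #|commuting_perms (x |: S)|)%N.
Proof.
move=> SR xR xS.
have inS a : a \in S -> a \in reps by move/(subsetP SR).
pose K := S :|: b @: S.
have inbS a : (a \in b @: S) = (b a \in S).
  by rewrite -{1}[a]b_inv (mem_imset _ _ (@perm_inj _ b)).
have Kb a : (b a \in K) = (a \in K) by rewrite !inE !inbS b_inv orbC.
have KR : K :&: reps = S.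
  apply/setP => a; rewrite !inE inbS; apply/andP/idP => [[/orP[] //]|aS].
    by move=> /inS; rewrite b_reps => /negP.
  by rewrite aS inS.
have xK : x \notin K.
  rewrite !inE inbS negb_or xS /=; apply/negP => /inS.
  by rewrite b_reps xR.
pose Y := ~: (x |: K).
have cardY : #|Y| = (2 * (#|reps| - #|S|)).-1.
  have := cardsC (x |: K); rewrite cardsU1 xK -/Y.
  rewrite (card_stable Kb) KR -cardsT (@card_stable [set: T]) ?setTI; first lia.
  by move=> a; rewrite !inE.
pose phi (s : {perm T}) := (s^-1)%g (b (s x)).
have phiE s y : (phi s == y) = (b (s x) == s y).
  by rewrite -(inj_eq (@perm_inj _ s)) permKV.
have phiY s : s \in commuting_perms S -> phi s \in Y.
  rewrite inE => /subsetP Ss; have {}Ss a : a \in K -> b (s a) = s (b a).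
    rewrite !inE inbS => /orP[] /Ss; rewrite ?commuting_pointsV inE => /eqP //.
  rewrite in_setC in_setU1 negb_or; apply/andP; split.
    by rewrite phiE b_neq.
  apply/negP => pK; have := Ss _ pK; rewrite permKV b_inv => /perm_inj xE.
  by move: xK; rewrite xE Kb => /negP[].
rewrite -sum1_card (partition_big phi (mem Y)) //= -cardY -sum_nat_const.
apply: eq_bigr => y yY; rewrite sum1dep_card.
pose t := tperm y (b x).
have tK a : a \in x |: K -> t a = a.
  move=> aK; apply: tpermD; apply/eqP => aE; move: aK; rewrite -aE.
    by apply/negP; move: yY; rewrite inE.
  by rewrite !inE (negPf (b_neq x)) -in_setU -/K Kb (negPf xK).
rewrite -(@on_card_preimset _ _ (fun s => t * s)%g); last first.
  by apply: onW_bij; exists (fun s => t^-1 * s)%g => s; rewrite ?mulKg ?mulKVg.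
apply: eq_card => s; rewrite !inE subUset sub1set andbC; congr andb.
  by rewrite phiE inE !permM tK ?inE ?eqxx // tpermL.
have SK a : a \in S -> a \in K by rewrite in_setU => ->.
apply/subsetP/subsetP => sub a aS; have := sub a aS; have aK := SK a aS.
  by rewrite !inE !permM !tK // in_setU1 ?Kb aK orbT.
by rewrite !inE !permM !tK // in_setU1 ?Kb aK orbT.
Qed.

(** With r = [#|reps|], the empty set gives all (2r)! permutations, and each further point of [S]
    cancels the largest remaining factor of (2r - 1)!!. *)
Lemma card_commuting_perms (S : {set T}) :
    S \subset reps ->
  #|commuting_perms S| =
    (2 ^ #|reps| * #|reps|`! * odd_fact (#|reps| - #|S|))%N.
Proof.
have [k] := ubnP #|S|; elim: k S => // k IHk S leSk SR.
have [->|[x xS]] := set_0Vmem S.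
  rewrite cards0 subn0 -fact_double (_ : (2 * #|reps|)%N = #|T|).
    rewrite -cardsT -card_perm; apply: eq_card => s; rewrite !inE sub0set.
    by apply/esym/subsetP => a; rewrite inE.
  by rewrite -cardsT (@card_stable [set: T]) ?setTI // => a; rewrite !inE.
have xR := subsetP SR x xS.
have S'R : S :\ x \subset reps by apply: subset_trans SR; apply: subsetDl.
have cardS : #|S| = #|S :\ x|.+1 by rewrite (cardsD1 x) xS.
have ltSR : (#|S :\ x| < #|reps|)%N by rewrite -cardS subset_leq_card.
have := card_commuting_perms_step S'R xR; rewrite setD11 setD1K // => /(_ isT).
rewrite IHk //; last by rewrite -ltnS -cardS.
have -> : (#|reps| - #|S :\ x|)%N = (#|reps| - #|S|).+1 by rewrite cardS subnSK.
rewrite odd_factS (_ : (2 * _.+1).-1 = (2 * (#|reps| - #|S|)).+1)%N; last lia.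
by rewrite mulnA [RHS]mulnC => /eqP; rewrite eqn_pmul2r // => /eqP.
Qed.

(** Double counting of the pairs (s, S), where S is an i-subset of [reps] on which s commutes with
    [b]. *)
Lemma sum_bin_commuting i :
  (\sum_(s : {perm T}) 'C(#|commuting_points s :&: reps|, i))%N =
    ('C(#|reps|, i) * (2 ^ #|reps| * #|reps|`! * odd_fact (#|reps| - i)))%N.
Proof.
transitivity (\sum_(s : {perm T})
    \sum_(S : {set T} | (S \subset reps) && (#|S| == i))
      (S \subset commuting_points s))%N.
  apply: eq_bigr => s _; rewrite -cards_draws -sum1dep_card.
  rewrite [LHS]big_mkcond [RHS]big_mkcond; apply: eq_bigr => S _.
  rewrite subsetI; case: (S \subset reps); rewrite ?andbF ?andbT //=.
  by case: (S \subset _); case: (_ == i).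
rewrite exchange_big -cards_draws -sum1dep_card big_distrl /=.
apply: eq_bigr => S /andP[SR /eqP <-]; rewrite mul1n -card_commuting_perms //.
by rewrite -sum1dep_card [RHS]big_mkcond; apply: eq_bigr => s _; case: (_ \subset _).
Qed.

End Commutation.

(** * Binomial inversion and the number of permutations at distance 2k *)

Lemma mul_bin_bin n k l : (l <= k)%N -> (k <= n)%N ->
  ('C(n, k) * 'C(k, l) = 'C(n, l) * 'C(n - l, k - l))%N.
Proof.
move=> lelk lekn; have leln := leq_trans lelk lekn.
have pos : (0 < l`! * (k - l)`! * (n - k)`!)%N by rewrite !muln_gt0 !fact_gt0.
have E := bin_fact (leq_sub2r l lekn).
rewrite (_ : n - l - (k - l) = n - k)%N in E; last lia.
apply/eqP; rewrite -(eqn_pmul2r pos); apply/eqP; transitivity n`!.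
  by rewrite -(bin_fact lekn) -(bin_fact lelk) !mulnA.
by rewrite -(bin_fact leln) -E; ring.
Qed.

(** Binomial theorem for (1 - 1)^n, padded with zero terms up to a bound [N] that can be shared by
    all n. *)
Lemma alternating_sum_bin (R : comNzRingType) (n N : nat) : (n <= N)%N ->
  \sum_(i < N.+1) (-1) ^+ i * 'C(n, i)%:R = (n == 0%N)%:R :> R.
Proof.
move=> lenN; transitivity ((1 - 1) ^+ n : R); last by rewrite subrr expr0n.
rewrite exprDn [RHS](big_ord_widen N.+1 (fun i => 1 ^+ (n - i) * (-1) ^+ i *+ 'C(n, i))) //.
rewrite [RHS]big_mkcond; apply: eq_bigr => i _; rewrite expr1n mul1r.
case: ltnP => [_|/bin_small ->]; first by rewrite mulr_natr.
by rewrite mulr0.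
Qed.

(** By [mul_bin_bin] the sum is C(e, q) times an alternating sum over the row e - q. For i < q the
    truncated exponent [i - q] is harmless, since C(i, q) = 0. *)
Lemma bin_inversion (R : comNzRingType) (e q N : nat) : (e <= N)%N ->
  \sum_(i < N.+1) (-1) ^+ (i - q) * 'C(i, q)%:R * 'C(e, i)%:R = (e == q)%:R :> R.
Proof.
move=> leeN.
have [lteq|leqe] := ltnP e q.
  rewrite (ltn_eqF lteq) big1 // => i _.
  have [ltiq|leqi] := ltnP i q; first by rewrite (bin_small ltiq) mulr0 mul0r.
  by rewrite [X in _ * X%:R]bin_small ?mulr0 // (leq_trans lteq).
pose F i : R := (-1) ^+ (i - q) * 'C(i, q)%:R * 'C(e, i)%:R.
rewrite -(big_mkord xpredT F) (@big_cat_nat _ _ _ q) ?leq0n //=; last by lia.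
rewrite big_nat big1 ?add0r => [|i /bin_small]; last first.
  by rewrite /F => ->; rewrite mulr0 mul0r.
rewrite -{1}[q]add0n big_addn big_mkord subSn; last exact: leq_trans leeN.
transitivity ('C(e, q)%:R *
    \sum_(i < (N - q).+1) (-1) ^+ i * 'C(e - q, i)%:R : R).
  rewrite big_distrr; apply: eq_bigr => i _; rewrite /F addnK /=.
  rewrite mulrCA -!mulrA -!natrM [('C(_, q) * _)%N]mulnC.
  have [le_iqe|lt_eiq] := leqP (i + q)%N e.
    by rewrite mul_bin_bin ?leq_addl // addnK.
  by rewrite !(@bin_small _ i, @bin_small e (i + q)) ?muln0 // ltn_subLR // addnC.
rewrite alternating_sum_bin ?leq_sub2r // subn_eq0 eqn_leq leqe andbT.
by case: leqP => [leeq|]; rewrite ?mulr0 ?mulr1 // (anti_leq (introT andP (conj leqe leeq))) binn.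
Qed.

(** Distance 2k means [e s = r - k]. This indicator is expanded by [bin_inversion], and the sum over
    s is then known from [sum_bin_commuting]. *)
Lemma card_hamming (R : comNzRingType) (T : finType) (b : {perm T}) (reps : {set T}) k :
    (forall a, b (b a) = a) -> (forall a, (b a \in reps) = (a \notin reps)) ->
  #|[set s : {perm T} | hamming (s * b)%g (b * s)%g == (2 * k)%N]|%:R =
    (2 ^ #|reps| * #|reps|`! * 'C(#|reps|, k))%:R *
    \sum_(l < k.+1) (-1) ^+ (k - l) * 'C(k, l)%:R * (odd_fact l)%:R :> R.
Proof.
move=> b_inv b_reps; pose r := #|reps|.
pose e (s : {perm T}) := #|commuting_points b s :&: reps|.
have le_er s : (e s <= r)%N by apply/subset_leq_card/subsetIr.
have [lekr|ltrk] := leqP k r; last first.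
  rewrite (bin_small ltrk) muln0 mul0r (_ : #|_| = 0%N) //.
  apply: eq_card0 => s; rewrite !inE (hamming_commuting b_inv b_reps).
  by apply/negP; rewrite -/(e s) -/r; lia.
transitivity (\sum_(s : {perm T}) (e s == r - k)%N%:R : R).
  rewrite -sum1dep_card natr_sum big_mkcond; apply: eq_bigr => s _.
  rewrite (hamming_commuting b_inv b_reps) -/(e s) -/r.
  rewrite (_ : (_ == _) = (e s == r - k)%N); first by case: (_ == _).
  by have := le_er s; lia.
pose w i : R := (-1) ^+ (i - (r - k)) * 'C(i, r - k)%:R.
transitivity (\sum_(s : {perm T}) \sum_(i < r.+1) w i * 'C(e s, i)%:R : R).
  by apply: eq_bigr => s _; rewrite bin_inversion.
rewrite exchange_big /=.
transitivity (\sum_(i < r.+1) w i *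
    ('C(r, i) * (2 ^ r * r`! * odd_fact (r - i)))%:R).
  apply: eq_bigr => i _; rewrite -(sum_bin_commuting b_inv b_reps) natr_sum.
  by rewrite big_distrr.
(* The substitution i = r - l makes the double factorial (2l - 1)!!; terms with l > k vanish because
   then C(r - l, r - k) = 0. *)
rewrite (reindex_inj rev_ord_inj) /= big_distrr /=.
pose F l : R := (2 ^ r * r`! * 'C(r, k))%:R *
  ((-1) ^+ (k - l) * 'C(k, l)%:R * (odd_fact l)%:R).
rewrite [RHS](big_ord_widen r.+1 F) ?ltnS // [RHS]big_mkcond.
apply: eq_bigr => l _; have lelr : (l <= r)%N by rewrite -ltnS.
rewrite /w subSS subKn //; case: ltnP => [lelk|ltkl]; last first.
  by rewrite [in X in X * _]bin_small ?mulr0 ?mul0r //; lia.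
rewrite ltnS in lelk; rewrite (_ : r - l - (r - k) = k - l)%N; last lia.
have := mul_bin_bin lelk lekr; rewrite -(@bin_sub (r - l) (k - l)); last lia.
rewrite (_ : r - l - (k - l) = r - k)%N; last lia.
rewrite -(bin_sub lelr) /F => /(congr1 (fun n => n%:R : R)).
rewrite !natrM => E.
transitivity ((-1) ^+ (k - l) * ('C(r, r - l)%:R * 'C(r - l, r - k)%:R) *
  ((2 ^ r)%:R * r`!%:R * (odd_fact l)%:R) : R); last by rewrite -E; ring.
by ring.
Qed.

(** * Products of disjoint transpositions as fixed-point free involutions *)

Lemma prod_tperm_disjoint (T : finType) (t : seq (T * T)) (p : T * T) :
    uniq (flatten [seq [:: p.1; p.2] | p <- t]) -> p \in t ->
  let s := (\prod_(p <- t) tperm p.1 p.2)%g in s p.1 = p.2 /\ s p.2 = p.1.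
Proof.
have fixed (t' : seq (T * T)) a : a \notin flatten [seq [:: p.1; p.2] | p <- t'] ->
    (\prod_(p <- t') tperm p.1 p.2)%g a = a.
  elim: t' => [|q t' IH] /=; first by rewrite big_nil perm1.
  rewrite !inE !negb_or big_cons permM => /and3P[aq1 aq2 at'].
  by rewrite tpermD ?IH // eq_sym.
elim: t => // q t IH /= /andP[]; rewrite inE negb_or => /andP[q12 q1t].
case/andP=> q2t t_uniq; rewrite inE big_cons !permM => /orP[/eqP->|pt].
  by rewrite tpermL tpermR !fixed.
have mem_entries a : a \in [:: p.1; p.2] ->
    a \in flatten [seq [:: p.1; p.2] | p <- t].
  by move=> ap; apply/flatten_mapP; exists p.
have tq a : a \in [:: p.1; p.2] -> tperm q.1 q.2 a = a.
  move=> /mem_entries at'; apply: tpermD; apply/eqP => aE; move: at'; rewrite -aE.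
    exact/negP.
  exact/negP.
by rewrite !tq ?inE ?eqxx ?orbT //; apply: IH.
Qed.

Lemma fpf_involutionP m (b : 'S_(2 * m)) : fpf_involution b ->
  (forall a, b (b a) = a) /\ (forall a, b a != a).
Proof.
case=> t /= [t_uniq t_all bE].
have bP a : exists2 p, p \in val t & (a = p.1 \/ a = p.2) /\ p.1 != p.2.
  have /flatten_mapP[p pt ap] := t_all a; exists p => //; split.
    by move: ap; rewrite !inE => /orP[] /eqP; [left | right].
  elim: (val t) t_uniq pt => //= q l IH /and3P[]; rewrite inE negb_or.
  by case/andP=> q12 _ _ l_uniq; rewrite inE => /orP[/eqP->|/IH] //; apply.
split=> a; have [p /(prod_tperm_disjoint t_uniq)] := bP a; rewrite -bE => -[p1 p2].
  by case=> -[] ->; rewrite ?p1 ?p2.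
by case=> -[] ->; rewrite ?p1 ?p2 // eq_sym.
Qed.

Lemma cnum_double (R : comNzRingType) m k (b : 'S_(2 * m)) : fpf_involution b ->
  (cnum (2 * k) b)%:R = (2 ^ m * m`! * 'C(m, k))%:R *
    \sum_(l < k.+1) (-1) ^+ (k - l) * 'C(k, l)%:R * (odd_fact l)%:R :> R.
Proof.
case/fpf_involutionP => b_inv b_neq.
(* The smaller point of each 2-cycle serves as its representative. *)
pose reps := [set a : 'I_(2 * m) | (a < b a)%N].
have b_reps a : (b a \in reps) = (a \notin reps).
  by rewrite !inE b_inv -leqNgt ltn_neqAle (inj_eq val_inj) b_neq.
have card_reps : #|reps| = m.
  have E : #|[set: 'I_(2 * m)]| = (2 * #|[set: 'I_(2 * m)] :&: reps|)%N.
    by apply: (card_stable b_inv b_reps) => a; rewrite !inE.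
  rewrite setTI cardsT card_ord in E.
  by move/eqP: E; rewrite eqn_pmul2l // => /eqP.
by rewrite /cnum (card_hamming R k b_inv b_reps) card_reps.
Qed.

(** * Constants and substitution in formal power series *)

Section FpsConst.
Variable R : comNzRingType.
Implicit Types f g : {fps R}.

Lemma fpsC_is_zmod_morphism : zmod_morphism (@fpsC R).
Proof.
move=> c d; apply: fpsP => n; rewrite fcoefB /=.
by case: eqP => _; rewrite ?subr0.
Qed.

Lemma fpsC_is_monoid_morphism : monoid_morphism (@fpsC R).
Proof. by split=> // c d; apply: fpsP => n; rewrite fcoefCM /=; case: eqP; rewrite ?mulr0. Qed.

HB.instance Definition _ :=
  GRing.isZmodMorphism.Build R {fps R} (@fpsC R) fpsC_is_zmod_morphism.
HB.instance Definition _ :=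
  GRing.isMonoidMorphism.Build R {fps R} (@fpsC R) fpsC_is_monoid_morphism.

Lemma fcoefXM f n : fcoef (fpsX * f) n = if n is k.+1 then fcoef f k else 0.
Proof.
rewrite fcoefM; case: n => [|n]; first by rewrite big_ord1 mul0r.
rewrite 2!big_ord_recl /= mul0r add0r mul1r subSS subn0 big1 ?addr0 // => i _.
by rewrite mul0r.
Qed.

Lemma fcoefXn k n : fcoef (fpsX ^+ k : {fps R}) n = (n == k)%:R.
Proof.
elim: k n => [|k IHk] n; first by rewrite expr0 fcoef1.
by rewrite exprS fcoefXM; case: n => [|n]; rewrite ?IHk.
Qed.

Lemma fcoef_mul_subst (a : nat -> R) f h n : fcoef f 0 = 0 ->
  fcoef (h * fps_subst a f) n = \sum_(k < n.+1) a k * fcoef (h * f ^+ k) n.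
Proof.
move=> f0; rewrite fcoefM.
transitivity (fcoef (h * \sum_(k < n.+1) fpsC (a k) * f ^+ k) n).
  by apply: eq_bigr => i _; rewrite (fps_substE _ f0 (N := n.+1)) // ltnS leq_subr.
rewrite mulr_sumr fcoef_sum; apply: eq_bigr => k _.
by rewrite mulrCA fcoefCM.
Qed.

Lemma fps_subst_eq (a b : nat -> R) f : a =1 b -> fps_subst a f = fps_subst b f.
Proof. by move=> ab; apply: fpsP => n; apply: eq_bigr => k _; rewrite ab. Qed.

Lemma fps_substZ (a : nat -> R) c f :
  fps_subst a (fpsC c * f) = fps_subst (fun k => a k * c ^+ k) f.
Proof.
apply: fpsP => n; apply: eq_bigr => k _.
by rewrite exprMn -rmorphXn fcoefCM mulrA.
Qed.

Lemma fps_subst_const f : fps_subst (fcoef (1 : {fps R})) f = 1.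
Proof.
apply: fpsP => n; rewrite /= big_ord_recl /= mul1r big1 ?addr0 // => k _.
by rewrite mul0r.
Qed.

(** Both sides are the double sum of a_i b_(s - i) f^s, arranged by i on the left and by s on the
    right. *)
Lemma fps_substM (a b : {fps R}) f : fcoef f 0 = 0 ->
  fps_subst (fcoef a) f * fps_subst (fcoef b) f = fps_subst (fcoef (a * b)) f.
Proof.
move=> f0; apply: fpsP => n.
pose F i s := fcoef a i * fcoef b (s - i) * fcoef (f ^+ s) n.
transitivity (\sum_(i < n.+1) \sum_(i <= s < n.+1) F i s).
  rewrite mulrC fcoef_mul_subst //; apply: eq_bigr => i _.
  rewrite [_ * f ^+ i]mulrC fcoef_mul_subst // mulr_sumr.
  transitivity (\sum_(0 <= k < n.+1) F i (k + i)%N).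
    rewrite big_mkord; apply: eq_bigr => k _; rewrite /F addnK exprD.
    by rewrite mulrA [f ^+ k * _]mulrC.
  have -> : \sum_(i <= s < n.+1) F i s = \sum_(0 <= k < n.+1 - i) F i (k + i)%N.
    by rewrite -{1}[val i]add0n big_addn.
  (* The terms with k + i > n drop out: f^(k + i) has no coefficient in degree n. *)
  rewrite (@big_cat_nat _ _ _ (n.+1 - i)) ?leq_subr //=.
  rewrite [X in _ + X]big_nat [X in _ + X]big1 ?addr0 // => k /andP[le_k _].
  by rewrite /F fcoefX_small ?mulr0 // addnC -leq_subLR.
transitivity (\sum_(i < n.+1) \sum_(s < n.+1 | (i < s.+1)%N) F i s).
  apply: eq_bigr => i _; rewrite -(big_mkord (fun s => i <= s)%N (F i)).
  rewrite [RHS](@big_cat_nat _ _ _ i) ?(ltnW (ltn_ord i)) //=.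
  have -> : \sum_(0 <= s < i | (i <= s)%N) F i s = 0.
    by rewrite big_nat_cond big1 // => s /andP[/andP[_ ltsi]]; rewrite leqNgt ltsi.
  rewrite add0r [LHS]big_nat [RHS]big_nat_cond; apply: eq_bigl => s.
  by case: (i <= s)%N; rewrite ?andbF ?andbT.
rewrite (exchange_big_dep xpredT) //=; apply: eq_bigr => s _.
by rewrite big_distrl /= [RHS](big_ord_widen n.+1 (F ^~ s)) ?ltn_ord.
Qed.

End FpsConst.

(** * The square root and exponential series and their inverses *)

Section BinomialSeries.
Variable R : comUnitRingType.
(** The section is meant for [{fps rat}], which is not a field, so the invertibility of positive
    integers is a hypothesis. *)
Hypothesis natr_unit : forall n, n.+1%:R \is a @GRing.unit R.

(* The hypotheses are the coefficient forms of the differential equations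
   [(1 - p x) f' = a f] and [(1 - p x) g' = - a g], which give [(f g)' = 0]. *)
Lemma fps_mul_const (f g : {fps R}) (p a : R) :
    (forall n, n.+1%:R * fcoef f n.+1 = (p * n%:R + a) * fcoef f n) ->
    (forall n, n.+1%:R * fcoef g n.+1 = (p * n%:R - a) * fcoef g n) ->
    fcoef f 0 = 1 -> fcoef g 0 = 1 ->
  f * g = 1.
Proof.
move=> Ef Eg f0 g0; apply: fpsP => n; rewrite fcoef1.
have step k : k.+1%:R * fcoef (f * g) k.+1 = p * k%:R * fcoef (f * g) k.
  (* Leibniz rule in coefficients: k + 1 is split as i + (k + 1 - i). *)
  transitivity (\sum_(i < k.+2) (i%:R * fcoef f i) * fcoef g (k.+1 - i) +
                \sum_(i < k.+2) fcoef f i * ((k.+1 - i)%:R * fcoef g (k.+1 - i))).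
    rewrite fcoefM mulr_sumr -big_split /=; apply: eq_bigr => i _.
    rewrite natrB; last by rewrite -ltnS.
    by ring.
  rewrite [in RHS]fcoefM big_ord_recl mul0r mul0r add0r [X in _ + X]big_ord_recr /=.
  rewrite subnn mul0r mulr0 addr0 -big_split mulr_sumr /=.
  apply: eq_bigr => i _; rewrite /bump add1n subSS Ef subSn; last by rewrite -ltnS.
  rewrite Eg natrB; last by rewrite -ltnS.
  by ring.
elim: n => [|n IHn]; first by rewrite fcoef0M f0 g0 mulr1.
apply: (mulrI (natr_unit n)); rewrite step IHn mulr0.
by case: n {IHn} => [|n]; rewrite mulr0 ?mul0r.
Qed.

Lemma factr_unit n : n`!%:R \is a @GRing.unit R.
Proof. by elim: n => [|n IHn]; rewrite ?unitr1 // factS natrM unitrM natr_unit. Qed.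

Lemma invf_factS n : n.+1%:R * (n.+1)`!%:R^-1 = n`!%:R^-1 :> R.
Proof.
by rewrite factS natrM invrM ?natr_unit ?factr_unit // mulrCA divrr ?mulr1.
Qed.

Definition fps_expX (a : R) : {fps R} := \fps_n (a ^+ n / n`!%:R).

Lemma fps_expXS a n :
  n.+1%:R * fcoef (fps_expX a) n.+1 = (0 * n%:R + a) * fcoef (fps_expX a) n.
Proof. by rewrite /= mulrCA invf_factS mul0r add0r exprS mulrA. Qed.

Lemma fps_expXN a : fps_expX a * fps_expX (- a) = 1.
Proof.
apply: (@fps_mul_const _ _ 0 a) => [n|n||]; rewrite ?fps_expXS //.
  by rewrite /= fact0 invr1 mulr1.
by rewrite /= fact0 invr1 mulr1.
Qed.

Lemma binom_halfS n :
  n.+1%:R * binom_half R n.+1 = (2^-1 - n%:R) * binom_half R n.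
Proof.
rewrite /binom_half big_ord_recr /= mulrCA invf_factS.
by rewrite mulrAC mulrC mulrA.
Qed.

(** The series (1 - 2x)^(1/2). *)
Definition sqrt_series : {fps R} := \fps_n (binom_half R n * (- 2) ^+ n).

(** The series (1 - 2x)^(-1/2). *)
Definition odd_fact_series : {fps R} := \fps_n ((odd_fact n)%:R / n`!%:R).

(** The two series satisfy (1 - 2x) f' = - f and (1 - 2x) g' = g. *)
Lemma sqrt_series_inv : sqrt_series * odd_fact_series = 1.
Proof.
have unit2 : (2%:R : R) \is a GRing.unit := natr_unit 1.
apply: (@fps_mul_const _ _ 2 (-1)) => [n|n||] /=.
- rewrite mulrA binom_halfS exprS.
  transitivity ((2 * 2^-1 * (-1) + 2 * n%:R) * (binom_half R n * (- 2) ^+ n)); first by ring.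
  by rewrite divrr // mul1r addrC.
- rewrite mulrCA invf_factS odd_factS natrM mulrAC mulrC; congr (_ * _).
  by rewrite -natr1 natrM opprK.
- by rewrite /binom_half big_ord0 fact0 invr1 !mulr1.
- by rewrite /odd_fact big_ord0 fact0 invr1 mulr1.
Qed.

(** Products of exponential generating functions are binomial convolutions; the signs come from
    exp(- x). *)
Lemma fcoef_odd_fact_exp (k : nat) :
  k`!%:R * fcoef (odd_fact_series * fps_expX (-1)) k =
    \sum_(l < k.+1) (-1) ^+ (k - l) * 'C(k, l)%:R * (odd_fact l)%:R.
Proof.
rewrite fcoefM mulr_sumr; apply: eq_bigr => l _ /=.
have lelk : (l <= k)%N by rewrite -ltnS.
rewrite -(bin_fact lelk) !natrM.
transitivity ((l`!%:R / l`!%:R) * ((k - l)`!%:R / (k - l)`!%:R) *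
  ((-1) ^+ (k - l) * 'C(k, l)%:R * (odd_fact l)%:R) : R); first by ring.
by rewrite !divrr ?factr_unit // !mul1r.
Qed.

Lemma cnum_fcoef m k (b : 'S_(2 * m)) : fpf_involution b ->
  fcoef (odd_fact_series * fps_expX (-1)) k * (2 ^ m * 'C(m, k))%:R =
    (cnum (2 * k) b)%:R / m`!%:R / k`!%:R.
Proof.
move=> b_fpf; rewrite (cnum_double R k b_fpf) -fcoef_odd_fact_exp.
move: (fcoef _ k) => d; rewrite !natrM.
transitivity (d * ((2 ^ m)%:R * 'C(m, k)%:R) *
  (m`!%:R / m`!%:R) * (k`!%:R / k`!%:R)); last by ring.
by rewrite !divrr ?factr_unit // !mulr1.
Qed.

(** Absorbing the factor -2 into the coefficients makes the root a substitution of [w] itself, like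
    the exponential, so that [fps_substM] applies. *)
Lemma fps_sqrt_subst (w : {fps R}) :
  fps_sqrt (1 - 2 * w) = fps_subst (fcoef sqrt_series) w.
Proof.
rewrite /fps_sqrt (_ : 1 - 2 * w - 1 = fpsC (- 2) * w) ?fps_substZ //.
by rewrite rmorphN rmorph_nat; ring.
Qed.

Lemma fps_exp_subst (w : {fps R}) : fps_exp w = fps_subst (fcoef (fps_expX 1)) w.
Proof. by apply: fps_subst_eq => k; rewrite /= expr1n mul1r. Qed.

Lemma fps_sqrt_exp_inv (w : {fps R}) : fcoef w 0 = 0 ->
  fps_sqrt (1 - 2 * w) * fps_exp w *
    fps_subst (fcoef (odd_fact_series * fps_expX (-1))) w = 1.
Proof.
move=> w0; rewrite fps_sqrt_subst fps_exp_subst !fps_substM //.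
rewrite mulrACA sqrt_series_inv fps_expXN mulr1.
exact: fps_subst_const.
Qed.

(** * Generating functions of the binomial columns, and assembly of the right-hand side *)

Definition bin_series (k : nat) : {fps R} := \fps_n (2 ^ n * 'C(n, k))%:R.

Lemma bin_series0 : (1 - 2 * fpsX) * bin_series 0 = 1.
Proof.
apply: fpsP => n; rewrite mulrBl mul1r -mulrA fcoefB mulr_natl fcoef1.
rewrite mulr2n fcoefD fcoefXM; case: n => [|n] /=.
  by rewrite bin0 addr0 subr0.
by rewrite !bin0 expnS -mulnA !mul2n -addnn natrD subrr.
Qed.

(** Pascal's rule, read on coefficients. *)
Lemma bin_seriesS k : (1 - 2 * fpsX) * bin_series k.+1 = 2 * fpsX * bin_series k.
Proof.
apply: fpsP => n; rewrite mulrBl mul1r -!mulrA fcoefB !mulr_natl.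
rewrite !mulr2n !fcoefD !fcoefXM; case: n => [|n] /=; first by rewrite !addr0 subr0.
by rewrite binS expnS !natrM natrD; ring.
Qed.

Lemma bin_seriesE k :
  (1 - 2 * fpsX)^-1 * (2 * fpsX / (1 - 2 * fpsX)) ^+ k = bin_series k.
Proof.
have U : (1 - 2 * fpsX : {fps R}) \is a GRing.unit.
  by apply/unitrPr; exists (bin_series 0); apply: bin_series0.
elim: k => [|k IHk]; first by apply: (mulrI U); rewrite bin_series0 expr0 mulr1 divrr.
by apply: (mulrI U); rewrite bin_seriesS -IHk exprS !mulrA divrr ?mul1r.
Qed.

(** The variable u enters only as a constant [c] of the coefficient ring, so a computation with
    power series in z alone suffices. *)
Lemma sqrt_exp_series_inv (c : R) (z := fpsX : {fps R}) (u := fpsC c) :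
  ((1 - 2 * z) * fps_sqrt (1 - 4 * z * u / (1 - 2 * z)) *
      fps_exp (2 * z * u / (1 - 2 * z)))^-1 =
    \fps_m (\sum_(k < m.+1) fcoef (odd_fact_series * fps_expX (-1)) k *
      ((2 ^ m * 'C(m, k))%:R * c ^+ k)).
Proof.
pose w := 2 * z * u / (1 - 2 * z).
have zU : 1 - 2 * z \is a GRing.unit.
  by apply/unitrPr; exists (bin_series 0); apply: bin_series0.
have w0 : fcoef w 0 = 0 by rewrite /w -!mulrA mulrCA fcoef0M mul0r.
have -> : 4 * z * u / (1 - 2 * z) = 2 * w by rewrite /w !mulrA -natrM.
set D := odd_fact_series * _.
transitivity ((1 - 2 * z)^-1 * fps_subst (fcoef D) w).
  apply: mulr1_eq; have := fps_sqrt_exp_inv w0; rewrite -/D => E.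
  by rewrite -[X in X * _]mulrA mulrACA E mulr1 divrr.
apply: fpsP => m; rewrite fcoef_mul_subst // [RHS]/=; apply: eq_bigr => k _.
(* Pulling out u^k leaves (2z)^k / (1 - 2z)^(k + 1), which is [bin_series k]. *)
congr (_ * _); have -> : w = u * (2 * z / (1 - 2 * z)) by rewrite /w mulrAC mulrC.
by rewrite exprMn mulrCA bin_seriesE -rmorphXn fcoefCM mulrC.
Qed.

End BinomialSeries.

Theorem theorem8 (beta : forall m : nat, 'S_(2 * m))
    (hbeta : forall m : nat, fpf_involution (beta m)) :
  let z : {fps {fps rat}} := fpsX in
  let u : {fps {fps rat}} := fpsC fpsX in
  (\fps_m (\fps_j
     ((cnum (2 * j) (beta m))%:R * (m`!%:R)^-1 * (j`!%:R)^-1)))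
  = ((1 - 2 * z) * fps_sqrt (1 - 4 * z * u / (1 - 2 * z))
       * fps_exp (2 * z * u / (1 - 2 * z)))^-1.
Proof.
move=> z u.
have natr_unit n : n.+1%:R \is a @GRing.unit {fps rat}.
  by rewrite -(rmorph_nat (@fpsC rat)) rmorph_unit // unitfE Num.Theory.pnatr_eq0.
rewrite sqrt_exp_series_inv //; apply: fpsP => m /=.
have coefE (k : 'I_m.+1) :
    fcoef (odd_fact_series _ * fps_expX (-1)) k * ((2 ^ m * 'C(m, k))%:R * fpsX ^+ k) =
    fpsC ((cnum (2 * k) (beta m))%:R / m`!%:R / k`!%:R) * fpsX ^+ k :> {fps rat}.
  (* [cnum_fcoef] holds in Q[[u]]; its value is a rational constant, which [fpsC] carries over from
     Q. *)
  rewrite mulrA (cnum_fcoef natr_unit _ (hbeta m)); congr (_ * _).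
  have fact_unit n : n`!%:R \is a @GRing.unit rat.
    by rewrite unitfE Num.Theory.pnatr_eq0 -lt0n fact_gt0.
  by rewrite !(rmorphM, rmorphV) //= !rmorph_nat.
rewrite (eq_bigr _ (fun k _ => coefE k)).
apply: fpsP => j; rewrite fcoef_sum [LHS]/=.
pose G k : rat := (cnum (2 * k) (beta m))%:R / m`!%:R / k`!%:R * (j == k)%:R.
rewrite (eq_bigr (fun k : 'I_m.+1 => G k)); last first.
  by move=> k _; rewrite fcoefCM fcoefXn.
have [lejm|ltmj] := ltnP j m.+1.
  rewrite (bigD1 (Ordinal lejm)) //= big1 ?addr0 /G ?eqxx ?mulr1 // => k.
  by rewrite -val_eqE /= eq_sym => /negPf->; rewrite mulr0.
(* For j > m the right-hand sum has no term u^j, and the count vanishes with C(m, j). *)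
rewrite (cnum_double _ _ (hbeta m)) (bin_small ltmj) muln0 !mul0r big1 // => k _.
by rewrite /G gtn_eqF ?mulr0 // (leq_ltn_trans _ ltmj) // -ltnS.
Qed.
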